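(* For any integer $n \geq 0$ and any two numbers $c, p$ we have $$D^n e^{c x^p} = e^{c x^p} x^{-n} \sum_{j=0}^{n} s(n,j)\, p^j \varphi_j(c\, x^p),$$ where $D = \frac{d}{dx}$, $s(n,j)$ are the (signed) Stirling numbers of the first kind and $\varphi_j$ are the exponential polynomials. In particular, when $c = 1$ and $p = -1$, $$D^n e^{1/x} = e^{1/x} x^{-n} \sum_{j=0}^{n} s(n,j)\,(-1)^j \varphi_j(1/x).$$
   Context: Here $D=\frac{d}{dx}$ is differentiation with respect to the variable $x$. The numbers $s(n,k)$ are the signed Stirling numbers of the first kind, $y(y-1)\cdots(y-n+1) = \sum_{k=0}^n s(n,k)\, y^k$, and $S(n,k)$ are the Stirling numbers of the second kind, $y^n=\sum_{k=0}^n S(n,k)\,y(y-1)\cdots(y-k+1)$. The exponential polynomials (also called single-variable Bell polynomials) are $$\varphi_m(x) = \sum_{k=0}^{m} S(m,k)\, x^k, \quad m = 0,1,2,\ldots$$ *)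

(* Defs.v *)
From Stdlib Require Import Reals ZArith Lra Lia.
From Coquelicot Require Import Coquelicot.

Open Scope C_scope.

Definition ZtoC (z : Z) : C := RtoC (IZR z).
Definition NtoC (n : nat) : C := RtoC (INR n).

(* y (y - 1) ... (y - n + 1) *)
Fixpoint falling (y : C) (n : nat) : C :=
  match n with
  | O => 1
  | S n' => falling y n' * (y - NtoC n')
  end.

(* Signed Stirling numbers of the first kind; see [falling_stirling1]. *)
Fixpoint stirling1 (n k : nat) : Z :=
  match n, k with
  | O, O => 1%Z
  | O, S _ => 0%Z
  | S n', O => (- Z.of_nat n' * stirling1 n' 0)%Z
  | S n', S k' => (stirling1 n' k' - Z.of_nat n' * stirling1 n' k)%Z
  end.

(* Stirling numbers of the second kind; see [pow_stirling2]. *)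
Fixpoint stirling2 (n k : nat) : nat :=
  match n, k with
  | O, O => 1%nat
  | O, S _ => 0%nat
  | S n', O => 0%nat
  | S n', S k' => (stirling2 n' k' + k * stirling2 n' k)%nat
  end.

(* [sum_n f m] is f 0 + ... + f m. *)
Definition exp_poly (m : nat) (x : C) : C :=
  sum_n (fun k => NtoC (stirling2 m k) * x ^ k) m.

Definition Cexp (z : C) : C :=
  (exp (fst z) * cos (snd z), exp (fst z) * sin (snd z))%R.

(* Principal logarithm of a nonzero real number: ln |x| + i Arg x,
   with Arg x = 0 for x > 0 and Arg x = PI for x < 0. *)
Definition Clog_real (x : R) : C :=
  (ln (Rabs x), if Rlt_dec x 0 then PI else 0%R).

(* Principal value of x^p for real x <> 0 and complex p. It is the usual real
   power when x > 0 and p is real ([Cpower_pos]) and the usual integer power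
   when p is an integer ([Cpower_Z]). *)
Definition Cpower (x : R) (p : C) : C := Cexp (p * Clog_real x).

(* l is the n-th derivative at x of the complex-valued function f of a real
   variable, the derivative being taken on real and imaginary parts. *)
Definition is_Cderive_n (f : R -> C) (n : nat) (x : R) (l : C) : Prop :=
  is_derive_n (fun t => fst (f t)) n x (fst l) /\
  is_derive_n (fun t => snd (f t)) n x (snd l).

(* [sum_n] may leave a goal over the carrier of [C_AbelianMonoid], which [ring]
   does not recognise. *)
Ltac Cring := match goal with |- ?a = ?b => change (@eq C a b) end; ring.

Lemma sum_n_Cmult_r (u : nat -> C) (a : C) (n : nat) :
  sum_n u n * a = sum_n (fun k => u k * a) n.
Proof.
  symmetry. exact (sum_n_mult_r (K := C_Ring) a u n).
Qed.

Lemma sum_n_Cplus (u v : nat -> C) (n : nat) :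
  sum_n u n + sum_n v n = sum_n (fun k => u k + v k) n.
Proof.
  symmetry. exact (sum_n_plus (G := C_AbelianMonoid) u v n).
Qed.

Lemma sum_n_C_last (u : nat -> C) (n : nat) :
  sum_n u (S n) = sum_n u n + u (S n).
Proof. exact (sum_Sn u n). Qed.

Lemma sum_n_C_first (u : nat -> C) (n : nat) :
  sum_n u (S n) = u O + sum_n (fun k => u (S k)) n.
Proof.
  induction n as [|n IH].
  - now rewrite sum_n_C_last, !sum_O.
  - rewrite sum_n_C_last, IH, sum_n_C_last. symmetry. apply Cplus_assoc.
Qed.

Lemma stirling1_gt n : forall k, (n < k)%nat -> stirling1 n k = 0%Z.
Proof.
  induction n as [|n IH]; intros [|k] Hk; simpl; try lia.
  rewrite (IH k), (IH (S k)); lia.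
Qed.

Lemma stirling2_gt n : forall k, (n < k)%nat -> stirling2 n k = 0%nat.
Proof.
  induction n as [|n IH]; intros [|k] Hk; try (simpl; lia).
  cbn [stirling2]. rewrite (IH k), (IH (S k)); lia.
Qed.

Lemma falling_stirling1 (y : C) (n : nat) :
  falling y n = sum_n (fun k => ZtoC (stirling1 n k) * y ^ k) n.
Proof.
  induction n as [|n IH].
  - rewrite sum_O. simpl. unfold ZtoC. Cring.
  - assert (E : falling y (S n) =
      sum_n (fun k => ZtoC (stirling1 n k) * y ^ k * y) n
      + sum_n (fun k => ZtoC (stirling1 n k) * y ^ k * - NtoC n) (S n)).
    { rewrite sum_n_C_last, (stirling1_gt n (S n)) by lia.
      rewrite <- !sum_n_Cmult_r, <- IH. simpl. unfold ZtoC. Cring. }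
    rewrite E, !sum_n_C_first.
    rewrite (Cplus_comm (_ * _ * - _)), Cplus_assoc, sum_n_Cplus, Cplus_comm.
    f_equal.
    + simpl stirling1. unfold ZtoC, NtoC.
      rewrite mult_IZR, opp_IZR, <- INR_IZR_INZ, RtoC_mult, RtoC_opp. Cring.
    + apply sum_n_ext; intros k. simpl stirling1. unfold ZtoC, NtoC.
      rewrite minus_IZR, mult_IZR, <- INR_IZR_INZ, RtoC_minus, RtoC_mult, Cpow_S.
      Cring.
Qed.

Lemma pow_stirling2 (y : C) (n : nat) :
  y ^ n = sum_n (fun k => NtoC (stirling2 n k) * falling y k) n.
Proof.
  induction n as [|n IH].
  - rewrite sum_O. simpl. unfold NtoC. simpl. Cring.
  - assert (E : y ^ S n =
      sum_n (fun k => NtoC (stirling2 n k) * falling y (S k)) n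
      + sum_n (fun k => NtoC k * NtoC (stirling2 n k) * falling y k) (S n)).
    { rewrite sum_n_C_last, (stirling2_gt n (S n)) by lia.
      rewrite Cpow_S, Cmult_comm, IH, sum_n_Cmult_r.
      replace (NtoC 0) with (RtoC 0) by reflexivity.
      rewrite Cmult_0_r, Cmult_0_l, Cplus_0_r, sum_n_Cplus.
      apply sum_n_ext; intros k. simpl falling. Cring. }
    rewrite E, !sum_n_C_first.
    rewrite (Cplus_comm (_ * _ * _)), Cplus_assoc, sum_n_Cplus, Cplus_comm.
    f_equal.
    + simpl stirling2. replace (NtoC 0) with (RtoC 0) by reflexivity. Cring.
    + apply sum_n_ext; intros k. cbn [stirling2]. unfold NtoC.
      rewrite plus_INR, mult_INR, RtoC_plus, RtoC_mult. Cring.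
Qed.

Lemma Cexp_RtoC (r : R) : Cexp (RtoC r) = RtoC (exp r).
Proof.
  unfold Cexp, RtoC; simpl. now rewrite cos_0, sin_0, Rmult_1_r, Rmult_0_r.
Qed.

Lemma Cexp_plus (z w : C) : Cexp (z + w) = Cexp z * Cexp w.
Proof.
  unfold Cexp, Cplus, Cmult; simpl.
  rewrite exp_plus, cos_plus, sin_plus. f_equal; ring.
Qed.

Lemma Cpower_pos (x p : R) :
  (0 < x)%R -> Cpower x (RtoC p) = RtoC (Rpower x p).
Proof.
  intros Hx. unfold Cpower, Clog_real, Rpower.
  destruct (Rlt_dec x 0) as [H|_]; [lra|].
  rewrite Rabs_pos_eq by lra.
  change (ln x, 0%R) with (RtoC (ln x)).
  now rewrite <- RtoC_mult, Cexp_RtoC.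
Qed.

Lemma Cexp_Clog_real (x : R) : x <> 0%R -> Cexp (Clog_real x) = RtoC x.
Proof.
  intros Hx. unfold Cexp, Clog_real; simpl.
  rewrite exp_ln by (apply Rabs_pos_lt; exact Hx).
  unfold RtoC. destruct (Rlt_dec x 0) as [H|H].
  - rewrite cos_PI, sin_PI, Rabs_left by lra. f_equal; ring.
  - rewrite cos_0, sin_0, Rabs_pos_eq by lra. f_equal; ring.
Qed.

Lemma Cpower_Z (x : R) (m : Z) :
  x <> 0%R -> Cpower x (ZtoC m) = RtoC (powerRZ x m).
Proof.
  intros Hx.
  assert (Hn : forall n : nat, Cpower x (NtoC n) = RtoC (x ^ n)).
  { induction n as [|n IH].
    - unfold Cpower, NtoC. simpl. rewrite Cmult_0_l, Cexp_RtoC. now rewrite exp_0.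
    - unfold Cpower, NtoC in *. rewrite S_INR, RtoC_plus, Cmult_plus_distr_r.
      rewrite Cexp_plus, IH, Cmult_1_l, Cexp_Clog_real by exact Hx.
      simpl. rewrite <- RtoC_mult. f_equal. ring. }
  destruct m as [|q|q]; unfold ZtoC.
  - exact (Hn O).
  - simpl powerRZ. rewrite <- Hn. unfold NtoC. now rewrite INR_IPR.
  - simpl powerRZ.
    assert (Hq : (x ^ Pos.to_nat q)%R <> 0%R) by (apply pow_nonzero; exact Hx).
    assert (E : Cpower x (RtoC (IZR (Z.neg q))) * RtoC (x ^ Pos.to_nat q) = 1).
    { rewrite <- Hn. unfold Cpower. rewrite <- Cexp_plus, <- Cmult_plus_distr_r.
      unfold NtoC. rewrite <- RtoC_plus, INR_IPR.
      change (IZR (Z.neg q)) with (- IPR q)%R.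
      rewrite Rplus_opp_l, Cmult_0_l, Cexp_RtoC. now rewrite exp_0. }
    rewrite RtoC_inv by exact Hq.
    assert (Hq' : RtoC (x ^ Pos.to_nat q) <> 0).
    { intros H. apply Hq. now apply RtoC_inj. }
    replace (Cpower x (RtoC (IZR (Z.neg q)))) with
      (Cpower x (RtoC (IZR (Z.neg q))) * RtoC (x ^ Pos.to_nat q)
         * / RtoC (x ^ Pos.to_nat q)) by (field; exact Hq').
    rewrite E. ring.
Qed.

(* Main.v *)
(** With z = c x^p and E = exp z one has x z' = p z, so the operator x D maps
    z^k E to p (k z^k + z^(k+1)) E.  The recurrence of the second-kind Stirling
    numbers turns this into x D (E phi_j(z)) = p E phi_(j+1)(z), and the
    recurrence of the first-kind ones, together with x D x^(-n) = - n x^(-n),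
    gives the induction step on the order of the derivative. *)
Require Import Defs.
From Stdlib Require Import Reals ZArith Lra Lia.
From Coquelicot Require Import Coquelicot.

Open Scope C_scope.

(** * Stirling recurrences summed against arbitrary weights *)

(** Shifting the index in the recurrence moves it from the coefficients onto the weights. The
    weights [w] stay arbitrary so that they can later hold [p ^ j * F j x]. *)
Lemma sum_n_stirling1_S (w : nat -> C) (n : nat) :
  sum_n (fun j => ZtoC (stirling1 (S n) j) * w j) (S n) =
  sum_n (fun j => ZtoC (stirling1 n j) * (w (S j) - NtoC n * w j)) n.
Proof.
  assert (E : sum_n (fun j => ZtoC (stirling1 n j) * (w (S j) - NtoC n * w j)) n =
    sum_n (fun j => ZtoC (stirling1 n j) * w (S j)) n
    + sum_n (fun j => ZtoC (stirling1 n j) * w j * - NtoC n) (S n)).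
  (* The second sum may run to [S n] because [stirling1 n (S n)] vanishes. Peeling off its term of
     index 0 then aligns the rest with the first sum. *)
  { rewrite sum_n_C_last, (stirling1_gt n (S n)) by lia.
    replace (ZtoC 0) with (RtoC 0) by reflexivity.
    rewrite !Cmult_0_l, Cplus_0_r, sum_n_Cplus.
    apply sum_n_ext; intros j. Cring. }
  symmetry. rewrite E, !sum_n_C_first, (Cplus_comm (_ * _ * - _)), Cplus_assoc,
    sum_n_Cplus, Cplus_comm.
  f_equal.
  - simpl stirling1. unfold ZtoC, NtoC.
    rewrite mult_IZR, opp_IZR, <- INR_IZR_INZ, RtoC_mult, RtoC_opp. Cring.
  - apply sum_n_ext; intros j. simpl stirling1. unfold ZtoC, NtoC.
    rewrite minus_IZR, mult_IZR, <- INR_IZR_INZ, RtoC_minus, RtoC_mult. Cring.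
Qed.

Lemma sum_n_stirling2_S (w : nat -> C) (n : nat) :
  sum_n (fun k => NtoC (stirling2 (S n) k) * w k) (S n) =
  sum_n (fun k => NtoC (stirling2 n k) * (w (S k) + NtoC k * w k)) n.
Proof.
  assert (E : sum_n (fun k => NtoC (stirling2 n k) * (w (S k) + NtoC k * w k)) n =
    sum_n (fun k => NtoC (stirling2 n k) * w (S k)) n
    + sum_n (fun k => NtoC k * NtoC (stirling2 n k) * w k) (S n)).
  { rewrite sum_n_C_last, (stirling2_gt n (S n)) by lia.
    replace (NtoC 0) with (RtoC 0) by reflexivity.
    rewrite Cmult_0_r, Cmult_0_l, Cplus_0_r, sum_n_Cplus.
    apply sum_n_ext; intros k. Cring. }
  symmetry. rewrite E, !sum_n_C_first, (Cplus_comm (_ * _ * _)), Cplus_assoc,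
    sum_n_Cplus, Cplus_comm.
  f_equal.
  (* The factor [NtoC k] kills the term [k = 0], in agreement with [stirling2 (S n) 0 = 0]. *)
  - simpl stirling2. replace (NtoC 0) with (RtoC 0) by reflexivity. Cring.
  - apply sum_n_ext; intros k. cbn [stirling2]. unfold NtoC.
    rewrite plus_INR, mult_INR, RtoC_plus, RtoC_mult. Cring.
Qed.

(** * First derivatives of complex-valued functions of a real variable *)

Definition is_Cderive (f : R -> C) (x : R) (l : C) : Prop :=
  is_derive (fun t => fst (f t)) x (fst l) /\
  is_derive (fun t => snd (f t)) x (snd l).

Lemma is_Cderive_ext_loc (f g : R -> C) (x : R) (l : C) :
  locally x (fun t => f t = g t) -> is_Cderive f x l -> is_Cderive g x l.
Proof.
  intros Hfg [H1 H2].
  split; eapply is_derive_ext_loc; try eassumption;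
    revert Hfg; apply filter_imp; now intros t ->.
Qed.

Lemma is_Cderive_const (a : C) (x : R) : is_Cderive (fun _ => a) x 0.
Proof. split; apply @is_derive_const. Qed.

Lemma is_Cderive_plus (f g : R -> C) (x : R) (lf lg : C) :
  is_Cderive f x lf -> is_Cderive g x lg ->
  is_Cderive (fun t => f t + g t) x (lf + lg).
Proof. intros [F1 F2] [G1 G2]. split; now apply @is_derive_plus. Qed.

(* The eta-expanded form is the one that [auto_derive] produces. *)
Lemma Derive_is_derive (h : R -> R) (x l : R) :
  is_derive h x l -> Derive (fun t : R => h t) x = l.
Proof. apply is_derive_unique. Qed.

Lemma is_Cderive_mult (f g : R -> C) (x : R) (lf lg : C) :
  is_Cderive f x lf -> is_Cderive g x lg ->
  is_Cderive (fun t => f t * g t) x (lf * g x + f x * lg).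
Proof.
  intros [F1 F2] [G1 G2].
  (* [auto_derive] only reifies variables as unknown functions, hence the
     detour through real functions in place of [fst (f t)] and the like. *)
  assert (H : forall a b c d : R -> R, forall la lb lc ld : R,
    is_derive a x la -> is_derive b x lb -> is_derive c x lc -> is_derive d x ld ->
    is_Cderive (fun t => (a t, b t) * (c t, d t)) x
      ((la, lb) * (c x, d x) + (a x, b x) * (lc, ld))).
  { intros a b c d la lb lc ld Ha Hb Hc Hd.
    split; simpl; auto_derive; repeat split; try (eexists; eassumption);
      rewrite (Derive_is_derive a _ _ Ha), (Derive_is_derive b _ _ Hb),
        (Derive_is_derive c _ _ Hc), (Derive_is_derive d _ _ Hd); ring. }
  exact (H (fun t => fst (f t)) (fun t => snd (f t))
           (fun t => fst (g t)) (fun t => snd (g t)) _ _ _ _ F1 F2 G1 G2).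
Qed.

Lemma is_Cderive_scal (a : C) (f : R -> C) (x : R) (l : C) :
  is_Cderive f x l -> is_Cderive (fun t => a * f t) x (a * l).
Proof.
  intros H. replace (a * l) with (0 * f x + a * l) by ring.
  apply (is_Cderive_mult (fun _ => a)); [apply is_Cderive_const | exact H].
Qed.

Lemma is_Cderive_sum_n (f : nat -> R -> C) (l : nat -> C) (x : R) (n : nat) :
  (forall k, is_Cderive (f k) x (l k)) ->
  is_Cderive (fun t => sum_n (fun k => f k t) n) x (sum_n l n).
Proof.
  intros H. induction n as [|n IH].
  - rewrite sum_O.
    apply is_Cderive_ext_loc with (f := f O); [|apply H].
    apply filter_forall; intros t. now rewrite sum_O.
  - rewrite sum_n_C_last.
    apply is_Cderive_ext_loc
      with (f := fun t => sum_n (fun k => f k t) n + f (S n) t).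
    + apply filter_forall; intros t. now rewrite sum_n_C_last.
    + now apply is_Cderive_plus.
Qed.

(** Writing the derivative of [f] as [f x * l], with [l] a logarithmic derivative, avoids the
    exponent [k - 1]: the power is merely multiplied by [k * l]. *)
Lemma is_Cderive_pow (f : R -> C) (x : R) (l : C) (k : nat) :
  is_Cderive f x (f x * l) ->
  is_Cderive (fun t => f t ^ k) x (f x ^ k * (NtoC k * l)).
Proof.
  intros H. induction k as [|k IH].
  - replace (NtoC 0) with (RtoC 0) by reflexivity.
    rewrite Cmult_0_l, Cmult_0_r. exact (is_Cderive_const 1 x).
  - replace (f x ^ S k * (NtoC (S k) * l))
      with (f x * l * f x ^ k + f x * (f x ^ k * (NtoC k * l))).
    + now apply is_Cderive_mult.
    + unfold NtoC. rewrite S_INR, RtoC_plus, Cpow_S. ring.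
Qed.

Lemma is_Cderive_exp (f : R -> C) (x : R) (l : C) :
  is_Cderive f x l -> is_Cderive (fun t => Cexp (f t)) x (Cexp (f x) * l).
Proof.
  intros [H1 H2].
  (* As in the product rule, real and imaginary parts become variables that [auto_derive] can
     reify. *)
  assert (H : forall a b : R -> R, forall la lb : R,
    is_derive a x la -> is_derive b x lb ->
    is_Cderive (fun t => Cexp (a t, b t)) x (Cexp (a x, b x) * (la, lb))).
  { intros a b la lb Ha Hb.
    split; simpl; auto_derive; repeat split; try (eexists; eassumption);
      rewrite (Derive_is_derive a _ _ Ha), (Derive_is_derive b _ _ Hb); ring. }
  exact (H (fun t => fst (f t)) (fun t => snd (f t)) _ _ H1 H2).
Qed.

(** * Logarithm and powers away from zero *)

Lemma locally_neq_0 (x : R) : x <> 0%R -> locally x (fun t => t <> 0%R).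
Proof. exact (open_neq 0 x). Qed.

(** On each open half-line the argument is constant ([PI] or 0), and both [ln (- t)] and [ln t] have
    derivative [1 / t]. *)
Lemma is_Cderive_log (x : R) :
  x <> 0%R -> is_Cderive Clog_real x (/ RtoC x).
Proof.
  intros Hx. rewrite <- RtoC_inv by exact Hx.
  destruct (Rlt_dec x 0) as [Hneg|Hpos].
  - apply is_Cderive_ext_loc with (f := fun t => (ln (- t), PI)).
    + generalize (open_lt 0 x Hneg). apply filter_imp; intros t Ht.
      unfold Clog_real. destruct (Rlt_dec t 0) as [_|Ht']; [|lra].
      now rewrite Rabs_left.
    + split; simpl; [|apply @is_derive_const].
      auto_derive; [lra | field; exact Hx].
  - apply is_Cderive_ext_loc with (f := fun t => (ln t, 0%R)).
    + assert (H0 : (0 < x)%R) by lra.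
      generalize (open_gt 0 x H0). apply filter_imp; intros t Ht.
      unfold Clog_real. destruct (Rlt_dec t 0) as [Ht'|_]; [lra|].
      now rewrite Rabs_pos_eq by lra.
    + split; simpl; [|apply @is_derive_const].
      auto_derive; [lra | field; exact Hx].
Qed.

Lemma is_Cderive_Cpower (p : C) (x : R) :
  x <> 0%R ->
  is_Cderive (fun t => Cpower t p) x (Cpower x p * (p * / RtoC x)).
Proof.
  intros Hx. apply is_Cderive_exp, is_Cderive_scal, is_Cderive_log, Hx.
Qed.

Lemma RtoC_neq_0 (x : R) : x <> 0%R -> RtoC x <> 0.
Proof. intros Hx H. now apply Hx, RtoC_inj. Qed.

Lemma is_Cderive_inv_pow (n : nat) (x : R) :
  x <> 0%R ->
  is_Cderive (fun t => / (RtoC t ^ n)) x (- NtoC n * / (RtoC x ^ S n)).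
Proof.
  intros Hx.
  apply is_Cderive_ext_loc with (f := fun t => RtoC (/ t ^ n)).
  - generalize (locally_neq_0 x Hx). apply filter_imp; intros t Ht.
    rewrite RtoC_inv by now apply pow_nonzero. now rewrite RtoC_pow.
  - unfold NtoC. rewrite <- RtoC_pow, <- RtoC_inv by now apply pow_nonzero.
    rewrite <- RtoC_opp, <- RtoC_mult.
    split; simpl; [|apply @is_derive_const].
    auto_derive; [now apply pow_nonzero|].
    (* The derivative of [t ^ n] contains [pred n], which is [n - 1] only for positive [n]. *)
    destruct n as [|n]; simpl pred; [simpl; field; exact Hx|].
    simpl pow. field. split; [now apply pow_nonzero | exact Hx].
Qed.

(** * The two Stirling steps *)

(** Termwise, the product rule gives the weights [z ^ S k + k * z ^ k] times [l], which
    [sum_n_stirling2_S] collects. It is used with [z = c * x ^ p] and [l = p / x]. *)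
Lemma is_Cderive_exp_mult_exp_poly (z : R -> C) (x : R) (l : C) (j : nat) :
  is_Cderive z x (z x * l) ->
  is_Cderive (fun t => Cexp (z t) * exp_poly j (z t)) x
    (l * (Cexp (z x) * exp_poly (S j) (z x))).
Proof.
  intros Hz.
  replace (l * (Cexp (z x) * exp_poly (S j) (z x))) with
    (Cexp (z x) * (z x * l) * exp_poly j (z x) + Cexp (z x) *
      sum_n (fun k => NtoC (stirling2 j k) * (z x ^ k * (NtoC k * l))) j).
  - apply is_Cderive_mult; [now apply is_Cderive_exp|].
    apply (is_Cderive_sum_n (fun k t => NtoC (stirling2 j k) * z t ^ k)).
    intros k. now apply is_Cderive_scal, is_Cderive_pow.
  - replace (l * (Cexp (z x) * exp_poly (S j) (z x)))
      with (Cexp (z x) * (exp_poly (S j) (z x) * l)) by ring.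
    replace (Cexp (z x) * (z x * l) * exp_poly j (z x))
      with (Cexp (z x) * (exp_poly j (z x) * (z x * l))) by ring.
    rewrite <- Cmult_plus_distr_l. f_equal.
    unfold exp_poly. rewrite sum_n_stirling2_S, !sum_n_Cmult_r, sum_n_Cplus.
    apply sum_n_ext; intros k. rewrite Cpow_S. Cring.
Qed.

(** Put [w j = p ^ j * F j x]. Differentiating the inverse power yields [- n * w j], differentiating
    [F j] yields [w (S j)], both over [x ^ S n]; [sum_n_stirling1_S] then applies. *)
Lemma is_Cderive_stirling1_sum (F : nat -> R -> C) (p : C) (n : nat) (x : R) :
  x <> 0%R ->
  (forall j, is_Cderive (F j) x (p * / RtoC x * F (S j) x)) ->
  is_Cderive
    (fun t => / (RtoC t ^ n) *
       sum_n (fun j => ZtoC (stirling1 n j) * (p ^ j * F j t)) n) x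
    (/ (RtoC x ^ S n) *
       sum_n (fun j => ZtoC (stirling1 (S n) j) * (p ^ j * F j x)) (S n)).
Proof.
  intros Hx HF.
  assert (Hx' := RtoC_neq_0 x Hx).
  assert (Hxn : RtoC x ^ n <> 0) by now apply Cpow_nz.
  replace (/ (RtoC x ^ S n) * _) with
    (- NtoC n * / (RtoC x ^ S n) *
       sum_n (fun j => ZtoC (stirling1 n j) * (p ^ j * F j x)) n +
     / (RtoC x ^ n) * sum_n (fun j => ZtoC (stirling1 n j) *
         (p ^ j * (p * / RtoC x * F (S j) x))) n).
  - apply is_Cderive_mult; [now apply is_Cderive_inv_pow|].
    apply (is_Cderive_sum_n (fun j t => ZtoC (stirling1 n j) * (p ^ j * F j t))).
    intros j. now apply is_Cderive_scal, is_Cderive_scal.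
  - rewrite (sum_n_stirling1_S (fun j => p ^ j * F j x)).
    rewrite (Cmult_comm (/ (RtoC x ^ n))), (Cmult_comm (- _ * _)),
      (Cmult_comm (/ _)), !sum_n_Cmult_r, sum_n_Cplus.
    apply sum_n_ext; intros j. rewrite !Cpow_S.
    match goal with |- ?a = ?b => change (@eq C a b) end.
    field. now split.
Qed.

(** * Higher derivatives and the formula *)

Lemma is_Cderive_n_ext_loc (f g : R -> C) (n : nat) (x : R) (l : C) :
  locally x (fun t => f t = g t) ->
  is_Cderive_n f n x l -> is_Cderive_n g n x l.
Proof.
  intros Hfg [H1 H2].
  split; eapply is_derive_n_ext_loc; try eassumption;
    revert Hfg; apply filter_imp; now intros t ->.
Qed.

(** The n-th derivative is known to equal [G n] only on [P]; since [P] is open, the equality holds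
    near each of its points and can be differentiated again. *)
Lemma is_Cderive_n_iterate (G : nat -> R -> C) (P : R -> Prop) :
  open P ->
  (forall n x, P x -> is_Cderive (G n) x (G (S n) x)) ->
  forall n x, P x -> is_Cderive_n (G O) n x (G n x).
Proof.
  intros HP HG n. induction n as [|n IH]; intros x Hx.
  - now split.
  - destruct (HG n x Hx) as [H1 H2].
    split; (eapply is_derive_ext_loc; [|eassumption]);
      generalize (HP x Hx); apply filter_imp; intros t Ht;
      symmetry; apply is_derive_n_unique; apply (IH t Ht).
Qed.

Lemma is_Cderive_n_Cexp_Cpower (n : nat) (c p : C) (x : R) :
  x <> 0%R ->
  is_Cderive_n (fun t : R => Cexp (c * Cpower t p)) n x
    (Cexp (c * Cpower x p) * / (RtoC x ^ n) *
     sum_n (fun j : nat =>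
              ZtoC (stirling1 n j) * p ^ j * exp_poly j (c * Cpower x p)) n).
Proof.
  intros Hx.
  set (F := fun j t => Cexp (c * Cpower t p) * exp_poly j (c * Cpower t p)).
  set (G := fun m t => / (RtoC t ^ m) *
              sum_n (fun j => ZtoC (stirling1 m j) * (p ^ j * F j t)) m).
  replace (_ * _ * sum_n _ _) with (G n x).
  - apply is_Cderive_n_ext_loc with (f := G O).
    (* At order 0 the inverse power, the Stirling numbers and [exp_poly 0] are all 1, so [G O] is
       the function itself. *)
    + apply filter_forall; intros t. unfold G, F, exp_poly.
      rewrite !sum_O. simpl. unfold ZtoC, NtoC. simpl. field.
    + apply (is_Cderive_n_iterate G (fun t => t <> 0%R)); trivial.
      * exact (open_neq 0).
      * intros m t Ht. apply is_Cderive_stirling1_sum; [exact Ht|].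
        intros j. apply (is_Cderive_exp_mult_exp_poly (fun t => c * Cpower t p)).
        rewrite <- Cmult_assoc. now apply is_Cderive_scal, is_Cderive_Cpower.
  - unfold G, F.
    rewrite (Cmult_comm (/ _)), (Cmult_comm (_ * _)), !sum_n_Cmult_r.
    apply sum_n_ext; intros j. Cring.
Qed.

Theorem proposition4 :
  (forall (n : nat) (c p : C) (x : R), x <> 0%R ->
     is_Cderive_n (fun t : R => Cexp (c * Cpower t p)) n x
       (Cexp (c * Cpower x p) * / (RtoC x ^ n) *
        sum_n (fun j : nat =>
                 ZtoC (stirling1 n j) * p ^ j * exp_poly j (c * Cpower x p)) n))
  /\
  (forall (n : nat) (x : R), x <> 0%R ->
     is_Cderive_n (fun t : R => RtoC (exp (1 / t))) n x
       (RtoC (exp (1 / x)) * / (RtoC x ^ n) *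
        sum_n (fun j : nat =>
                 ZtoC (stirling1 n j) * RtoC (-1) ^ j
                 * exp_poly j (RtoC (1 / x))) n)).
Proof.
  split; [exact is_Cderive_n_Cexp_Cpower|].
  intros n x Hx.
  (* The principal power with the integer exponent -1 is the reciprocal, for negative [t] as well,
     so this is the case [c = 1], [p = -1]. *)
  assert (Hz : forall t, t <> 0%R -> 1 * Cpower t (RtoC (-1)) = RtoC (1 / t)).
  { intros t Ht. rewrite Cmult_1_l. change (RtoC (-1)) with (ZtoC (-1)).
    rewrite Cpower_Z by exact Ht. f_equal. simpl. field. exact Ht. }
  rewrite <- Cexp_RtoC, <- (Hz x Hx).
  eapply is_Cderive_n_ext_loc; [|now apply is_Cderive_n_Cexp_Cpower].
  generalize (locally_neq_0 x Hx). apply filter_imp; intros t Ht.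
  now rewrite (Hz t Ht), Cexp_RtoC.
Qed.
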